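(* Let $\mu$ be a Borel probability measure on $\mathbb{R}$ with $m_1(\mu)=0$, $m_2(\mu)=1$ and $m_4(\mu)<\infty$, where $m_k(\mu)=\int_{\mathbb{R}}x^k\,d\mu(x)$. For $n\ge 1$ let $\mu_n=D_{1/\sqrt{n}}\,\mu^{\uplus n}$. Then for every $n\ge 1$, $$L(\mu_n,\mathbf{b})\le \frac{7}{2}\sqrt[3]{\frac{m_4(\mu)-1}{n}}.$$
   Context: For a Borel probability measure $\mu$ on $\mathbb{R}$ and $a>0$, the dilation $D_a\mu$ is defined by $D_a\mu(B)=\mu(a^{-1}B)$ for Borel $B\subset\mathbb{R}$. The Cauchy transform is $G_\mu(z)=\int_{\mathbb{R}}\frac{1}{z-t}\,d\mu(t)$ for $z\in\mathbb{C}^+$ (open upper half-plane), $F_\mu(z)=1/G_\mu(z)$, and $K_\mu(z)=z-F_\mu(z)$. The Boolean convolution $\mu\uplus\nu$ of probability measures $\mu,\nu$ on $\mathbb{R}$ is the unique probability measure with $K_{\mu\uplus\nu}(z)=K_\mu(z)+K_\nu(z)$ for all $z\in\mathbb{C}^+$; $\mu^{\uplus n}$ is the $n$-fold Boolean convolution of $\mu$ with itself. $\mathbf{b}=\frac12\delta_{-1}+\frac12\delta_1$ is the Bernoulli distribution. The Lévy distance between probability measures $\mu,\nu$ with distribution functions $F,G$ is $L(\mu,\nu)=\inf\{\epsilon>0: F(x-\epsilon)-\epsilon\le G(x)\le F(x+\epsilon)+\epsilon \text{ for all } x\in\mathbb{R}\}$. *)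

(* Defs.v *)
From HB Require Import structures.
From mathcomp Require Import all_boot all_order all_algebra.
From mathcomp Require Import all_classical all_reals all_analysis.
From mathcomp Require Import complex.
Import Order.TTheory GRing.Theory Num.Theory.
Import numFieldNormedType.Exports.
Local Open Scope classical_set_scope.
Local Open Scope ring_scope.

Set Implicit Arguments.
Unset Strict Implicit.
Unset Printing Implicit Defensive.

Section Defs.
Variable R : realType.

Definition moment (mu : probability R R) (k : nat) : \bar R :=
  (\int[mu]_x (x ^+ k)%:E)%E.

(* Cauchy transform G_mu(z) = int 1/(z-t) dmu(t), written via real and
   imaginary parts: 1/(z-t) = ((x-t) - i y)/((x-t)^2 + y^2) for z = x + iy. *)
Definition cauchyG (mu : probability R R) (z : complex.complex R) : complex.complex R :=
  let x := complex.Re z in let y := complex.Im z in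
  complex.Complex
    (Rintegral mu setT (fun t => (x - t) / ((x - t) ^+ 2 + y ^+ 2)))
    (Rintegral mu setT (fun t => - y / ((x - t) ^+ 2 + y ^+ 2))).

Definition cauchyF (mu : probability R R) (z : complex.complex R) :=
  (cauchyG mu z)^-1.
Definition Ktrans (mu : probability R R) (z : complex.complex R) :=
  z - cauchyF mu z.

Definition is_boolean_power (mu : probability R R) (n : nat) (nu : probability R R) :=
  forall z : complex.complex R, 0 < complex.Im z ->
    Ktrans nu z = n%:R * Ktrans mu z.

Definition cdf (mu : probability R R) (x : R) : R := fine (mu `]-oo, x]%classic).

(* distribution function of the dilation D_a mu:
   D_a mu(]-oo,x]) = mu(a^{-1} ]-oo,x]) = mu(]-oo, x/a]) for a > 0 *)
Definition dilation_cdf (a : R) (mu : probability R R) (x : R) : R :=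
  fine (mu `]-oo, x / a]%classic).

Definition bern (A : set R) : \bar R :=
  ((1/2)%:E * \d_((-1)%R : R) A + (1/2)%:E * \d_((1)%R : R) A)%E.
Definition bern_cdf (x : R) : R := fine (bern `]-oo, x]%classic).

Definition levy (F G : R -> R) : R :=
  inf [set e : R | 0 < e /\
        forall x : R, F (x - e) - e <= G x /\ G x <= F (x + e) + e].

End Defs.

(* Main.v *)
Require Import Defs.
From HB Require Import structures.
From mathcomp Require Import all_boot all_order all_algebra.
From mathcomp Require Import all_classical all_reals all_analysis.
From mathcomp Require Import measurable_realfun complex.
From mathcomp Require Import ring lra.
Import Order.TTheory GRing.Theory Num.Theory.
Import numFieldNormedType.Exports.
Local Open Scope classical_set_scope.
Local Open Scope ring_scope.

(** At [z = iY], [1 - z G(z)] is [P2 / Y^2 + i P1 / Y], where [Pj] is the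
    integral of [t^j] damped by the factor [Y^2 / (t^2 + Y^2)].  The Boolean
    power relation therefore expresses the damped moments of [nu] rationally
    through those of [mu]; letting [Y] go to infinity, monotone convergence
    shows that [nu] has a fourth moment and that, after rescaling, it has mean
    [0], variance [1] and [E (X^2 - 1)^2 = d := (m4 - 1) / n].  Hence [X^2] is
    close to [1] by Chebyshev's inequality, and mean zero forces about half of
    the mass near each of [-1] and [1]; optimising gives distance [O(d^(1/3))]. *)

(** * The damping factor and its limit *)

(** This is [Y^2 / (t^2 + Y^2)], in a form that lies in []0, 1]] for every [Y]: at [Y = 0] the
    quotient is [0] by convention and the factor is [1]. *)
Definition damp {R : realType} (Y t : R) : R := (1 + t ^+ 2 / Y ^+ 2)^-1.

Definition damped_moment {R : realType} (P : probability R R) (j : nat) (Y : R) : R :=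
  \int[P]_t (t ^+ j * damp Y t).

Lemma damp_gt0 {R : realType} (Y t : R) : 0 < damp Y t.
Proof. by rewrite invr_gt0 ltr_pwDl// divr_ge0// sqr_ge0. Qed.

Lemma damp_le1 {R : realType} (Y t : R) : damp Y t <= 1.
Proof.
by rewrite invf_le1 ?ltr_pwDl// ?lerDl ?divr_ge0// ?sqr_ge0.
Qed.

Lemma le_damp {R : realType} (Y Z t : R) : 0 < Y -> Y <= Z -> damp Y t <= damp Z t.
Proof.
move=> Y0 YZ; have Z0 := lt_le_trans Y0 YZ.
rewrite lef_pV2 ?posrE ?ltr_pwDl// ?divr_ge0 ?sqr_ge0//.
rewrite lerD2l ler_wpM2l ?sqr_ge0// lef_pV2 ?posrE ?exprn_gt0//.
by rewrite ler_pXn2r// nnegrE ltW.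
Qed.

(** Damping trades two powers of [t] for a factor [Y^2]; the boundedness of low damped moments and
    the recursion on their order both rest on this identity. *)
Lemma dampB {R : realType} (Y t : R) : 0 < Y ->
  t ^+ 2 * damp Y t = Y ^+ 2 * (1 - damp Y t).
Proof.
move=> Y0; have := damp_gt0 Y t; rewrite /damp invr_gt0 => /lt0r_neq0 d0.
apply: (mulIf d0); rewrite (divfK d0) -[Y ^+ 2 * _ * _]mulrA mulrBl (mulVf d0).
by field; rewrite gt_eqF.
Qed.

Lemma cvg_shift2V {R : realType} : ((k.+2%:R : R)^-1) @[k --> \oo] --> (0 : R).
Proof.
by have := @cvg_harmonic R; rewrite -(@cvg_shiftS R).
Qed.

Lemma cvg_shift2Vsqr {R : realType} :
  ((k.+2%:R ^+ 2 : R)^-1) @[k --> \oo] --> (0 : R).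
Proof.
under eq_fun do rewrite -exprVn expr2.
suff : (k.+2%:R^-1 * k.+2%:R^-1) @[k --> \oo] --> (0 * 0 : R) by rewrite mulr0.
by apply: cvgM; exact: cvg_shift2V.
Qed.

Lemma cvg_damp {R : realType} (t : R) : damp k.+2%:R t @[k --> \oo] --> (1 : R).
Proof.
suff : damp k.+2%:R t @[k --> \oo] --> (1 + t ^+ 2 * 0)^-1 by rewrite mulr0 addr0 invr1.
apply: cvgV; first by rewrite mulr0 addr0 oner_neq0.
apply: cvgD; first exact: cvg_cst.
by apply: cvgMr; exact: cvg_shift2Vsqr.
Qed.

Lemma measurable_damp {R : realType} (Y : R) : measurable_fun setT (damp Y).
Proof.
apply: continuous_measurable_fun => t; apply: cvgV.
  by rewrite gt_eqF// ltr_pwDl// divr_ge0 ?sqr_ge0.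
apply: cvgD; first exact: cvg_cst.
by apply: cvgMl; exact: exprn_continuous.
Qed.

Lemma measurable_damped {R : realType} (j : nat) (Y : R) :
  measurable_fun setT (fun t : R => t ^+ j * damp Y t).
Proof. by apply: measurable_funM; [exact: exprn_measurable|exact: measurable_damp]. Qed.

(** * Damped moments and the Cauchy transform on the imaginary axis *)

(** The integrand is bounded by [Y^j], so no moment of [P] is assumed. This matters for the Boolean
    power, whose moments are not known to exist beforehand. *)
Lemma integrable_damped_le2 {R : realType} (P : probability R R) (j : nat) (Y : R) :
  (j <= 2)%N -> 0 < Y ->
  P.-integrable setT (EFin \o (fun t : R => t ^+ j * damp Y t)).
Proof.
move=> j2 Y0.
apply: (le_integrable measurableT _ _
  (finite_measure_integrable_cst P (Y ^+ j) measurableT)).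
  by apply/measurable_EFinP; apply: measurable_damped.
move=> t _ /=; rewrite lee_fin [leRHS]ger0_norm; last by rewrite exprn_ge0// ltW.
have Y0' := ltW Y0; have d0 := damp_gt0 Y t; have d1 := damp_le1 Y t; have Bt := dampB Y t Y0.
case: j j2 => [|[|[|//]]] _.
- by rewrite !expr0 mul1r gtr0_norm.
- rewrite !expr1 -ler_sqr ?nnegrE// real_normK ?num_real//.
  have -> : (t * damp Y t) ^+ 2 = Y ^+ 2 * ((1 - damp Y t) * damp Y t).
    by rewrite mulrA -Bt; ring.
  by rewrite ler_piMr ?sqr_ge0//; nra.
- rewrite Bt ger0_norm ?mulr_ge0 ?sqr_ge0 ?subr_ge0//.
  by rewrite ler_piMr ?sqr_ge0// lerBlDr lerDl ltW.
Qed.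

Lemma integrable_damped {R : realType} (P : probability R R) (j : nat) (Y : R) :
  P.-integrable setT (EFin \o (fun t : R => t ^+ j)) ->
  P.-integrable setT (EFin \o (fun t : R => t ^+ j * damp Y t)).
Proof.
move=> ij; apply: (le_integrable measurableT _ _ ij).
  by apply/measurable_EFinP; apply: measurable_damped.
move=> t _ /=; rewrite lee_fin normrM ler_piMr//.
by rewrite gtr0_norm ?damp_gt0// damp_le1.
Qed.

(** The imaginary part is [-1/Y] times the damped moment of order [0], which [dampB] turns into
    [1 - P2 / Y^2]. *)
Lemma cauchyG_imag {R : realType} (P : probability R R) (Y : R) : 0 < Y ->
  cauchyG P (Complex 0 Y) =
  Complex (- (damped_moment P 1 Y / Y ^+ 2))
          (- ((1 - damped_moment P 2 Y / Y ^+ 2) / Y)).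
Proof.
move=> Y0; rewrite /cauchyG/=.
have dE t : (damp Y t)^-1 = (t ^+ 2 + Y ^+ 2) / Y ^+ 2.
  by rewrite invrK; field; rewrite gt_eqF.
have nz t : t ^+ 2 + Y ^+ 2 != 0 by rewrite gt_eqF// ltr_wpDl ?sqr_ge0 ?exprn_gt0.
have {}dE t : damp Y t = Y ^+ 2 / (t ^+ 2 + Y ^+ 2).
  by rewrite -[LHS]invrK dE invf_div.
have i1 := integrable_damped_le2 P 1 Y isT Y0.
have i2 := integrable_damped_le2 P 2 Y isT Y0.
have i0 := integrable_damped_le2 P 0 Y isT Y0.
congr Complex.
- transitivity (\int[P]_t (- (Y ^+ 2)^-1 * (t ^+ 1 * damp Y t))).
    apply: eq_Rintegral => t _; rewrite dE; field.
    by rewrite ?nz ?gt_eqF//.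
  by rewrite RintegralZl// mulNr mulrC.
- transitivity (\int[P]_t (- Y^-1 * (t ^+ 0 * damp Y t))).
    apply: eq_Rintegral => t _; rewrite dE; field.
    by rewrite ?nz ?gt_eqF//.
  rewrite RintegralZl// mulNr mulrC; congr (- (_ * _)).
  transitivity (\int[P]_t (1 - (Y ^+ 2)^-1 * (t ^+ 2 * damp Y t))).
    by apply: eq_Rintegral => t _; rewrite dE; field; rewrite nz gt_eqF.
  rewrite RintegralB//.
  + rewrite Rintegral_cst// RintegralZl//.
    have P1 : fine (P setT) = 1 by rewrite probability_setT.
    by rewrite mul1r; congr (_ - _); [exact: P1|rewrite mulrC].
  + exact: (finite_measure_integrable_cst P 1).
  + exact: (integrableZl _ _ i2).
Qed.

(** * Passage between damped and ordinary moments *)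

(** Multiply [dampB] by [t^j]. The rate at which the damped moment of order [j] reaches its limit
    thus encodes the moment of order [j + 2], which allows climbing from order 2 to order 4. *)
Lemma damped_momentSS {R : realType} (P : probability R R) (j : nat) (Y : R) :
  0 < Y -> P.-integrable setT (EFin \o (fun t : R => t ^+ j)) ->
  P.-integrable setT (EFin \o (fun t : R => t ^+ j.+2 * damp Y t)) /\
  damped_moment P j.+2 Y = Y ^+ 2 * (\int[P]_t (t ^+ j) - damped_moment P j Y).
Proof.
move=> Y0 ij; have ijd := integrable_damped P j Y ij.
have E t : t ^+ j.+2 * damp Y t = Y ^+ 2 * (t ^+ j - t ^+ j * damp Y t).
  rewrite -addn2 exprD -mulrA dampB//; ring.
have ijB := integrableB measurableT ij ijd.
split.
  apply: (eq_integrable measurableT _ _ _ (integrableZl measurableT (Y ^+ 2) ijB)).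
  by move=> t _ /=; rewrite E.
rewrite /damped_moment -RintegralB// -RintegralZl//.
by apply: eq_Rintegral => t _; rewrite E.
Qed.

Lemma cvg_damped_moment {R : realType} (P : probability R R) (j : nat) :
  P.-integrable setT (EFin \o (fun t : R => t ^+ j)) ->
  damped_moment P j k.+2%:R @[k --> \oo] --> \int[P]_t (t ^+ j).
Proof.
move=> ij; apply: fine_cvg.
rewrite fineK; last exact: integrable_fin_num ij.
apply: (@dominated_cvg _ _ _ P setT measurableT
  (fun k t => (t ^+ j * damp k.+2%:R t)%:E) (fun t => (t ^+ j)%:E)
  (fun t => `|t ^+ j|%:E)) => //.
- by move=> k; apply/measurable_EFinP; apply: measurable_damped.
- move=> t _; apply: cvg_EFin; first exact: nearW.
  suff : t ^+ j * damp k.+2%:R t @[k --> \oo] --> t ^+ j * 1 by rewrite mulr1.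
  by apply: cvgMr; exact: cvg_damp.
- by have := integrable_norm ij.
- move=> k t _; rewrite /= lee_fin normrM ler_piMr//.
  by rewrite gtr0_norm ?damp_gt0// damp_le1.
Qed.

(** A converse to [cvg_damped_moment]: for even [j] the damped integrands are nonnegative and
    increase with [k], so monotone convergence yields the existence of the moment from a finite
    limit. *)
Lemma integrable_of_cvg_damped_moment {R : realType} (P : probability R R)
  (j : nat) (l : R) : ~~ odd j ->
  (forall k, P.-integrable setT (EFin \o (fun t : R => t ^+ j * damp k.+2%:R t))) ->
  damped_moment P j k.+2%:R @[k --> \oo] --> l ->
  P.-integrable setT (EFin \o (fun t : R => t ^+ j)) /\ \int[P]_t (t ^+ j) = l.
Proof.
move=> oj ijd cvl.
pose g k (t : R) := (t ^+ j * damp k.+2%:R t)%:E.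
have lim_g t : limn (g ^~ t) = (t ^+ j)%:E.
  apply/cvg_lim => //; apply: cvg_EFin; first exact: nearW.
  suff : t ^+ j * damp k.+2%:R t @[k --> \oo] --> t ^+ j * 1 by rewrite mulr1.
  by apply: cvgMr; exact: cvg_damp.
have tj0 (t : R) : 0 <= t ^+ j by rewrite exprn_even_ge0.
have : (\int[P]_t (g k t))%E @[k --> \oo] --> (\int[P]_t (t ^+ j)%:E)%E.
  under [X in _ --> X]eq_integral do rewrite -lim_g.
  apply: cvg_monotone_convergence => //.
  - by move=> k; apply/measurable_EFinP; apply: measurable_damped.
  - by move=> k t _; rewrite lee_fin mulr_ge0// ltW// damp_gt0.
  - move=> t _ a b ab; rewrite lee_fin ler_wpM2l//.
    by rewrite le_damp ?ltr0n// ler_nat !ltnS.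
have cvE : (\int[P]_t (g k t))%E @[k --> \oo] --> l%:E.
  apply: cvg_EFin; last exact: cvl.
  by apply: nearW => k; exact: (integrable_fin_num measurableT (ijd k)).
move=> /(cvg_unique (@ereal_hausdorff R) cvE) intE.
split; last by rewrite /Rintegral -intE.
apply/integrableP; split; first exact/measurable_EFinP.
under eq_integral do rewrite /= ger0_norm//.
by rewrite -intE ltry.
Qed.

(** * Damped moments of a Boolean power *)

(* With [u = 1 - z G_mu(z)] the Boolean power relation reads
   [G_mu = G_nu * (1 + (n-1) u)], whose real and imaginary parts at [z = iY]
   determine the damped moments of [nu]. *)
Lemma boolean_power_solve {R : realType} (n : nat) (Y p1 p2 q1 q2 : R) :
  (1 <= n)%N -> 0 < Y -> 0 <= p2 < Y ^+ 2 ->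
  let z := Complex 0 Y in
  let G a b := Complex (- (a / Y ^+ 2)) (- ((1 - b / Y ^+ 2) / Y)) in
  z - (G q1 q2)^-1 = n%:R * (z - (G p1 p2)^-1) ->
  let D := (1 + (n%:R - 1) * (p2 / Y ^+ 2)) ^+ 2
           + ((n%:R - 1) * (p1 / Y)) ^+ 2 in
  q1 = n%:R * p1 / D /\
  q2 = n%:R * (p2 + (n%:R - 1) * (p2 ^+ 2 / Y ^+ 2 + p1 ^+ 2)) / D.
Proof.
move=> n1 Y0 /andP[p20 p2Y] z G K D.
have Y20 : 0 < Y ^+ 2 by rewrite exprn_gt0.
have Yn0 : Y != 0 by rewrite gt_eqF.
have n1' : 1 <= n%:R :> R by rewrite ler1n.
have Gp0 : G p1 p2 != 0.
  rewrite eq_complex/= negb_and orbC oppr_eq0 mulf_neq0 ?invr_eq0//.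
  by rewrite subr_eq0 eq_sym lt_eqF// ltr_pdivrMr// mul1r.
set a := 1 + (n%:R - 1) * (p2 / Y ^+ 2).
set b := (n%:R - 1) * (p1 / Y).
have a0 : 1 <= a by rewrite lerDl mulr_ge0 ?subr_ge0// divr_ge0// ltW.
(* [Complex a b] is [1 + (n-1) u], and [D] is its squared modulus. *)
have E : (G q1 q2)^-1 * G p1 p2 = Complex a b.
  have -> : (G q1 q2)^-1 = (1 - n%:R) * z + n%:R * (G p1 p2)^-1.
    rewrite -[LHS](subKr z) K; ring.
  rewrite mulrDl -[n%:R * _ * _]mulrA mulVf// mulr1.
  have -> : n%:R = Complex (n%:R : R) 0 by rewrite -(rmorph_nat (real_complex R)).
  have -> : (1 : R[i]%C) = Complex 1 0 by [].
  apply/eqP; rewrite eq_complex/=; apply/andP; split; apply/eqP; rewrite /a /b; field; exact: Yn0.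
(* Since [0^-1 = 0] by convention, a vanishing [G q1 q2] would force [a = 0], against [1 <= a]. *)
have Gq0 : G q1 q2 != 0.
  apply/eqP => G0; move: E; rewrite G0 invr0 mul0r => -[a1 _].
  by rewrite -a1 ler10 in a0.
have {}E : G p1 p2 = G q1 q2 * Complex a b by rewrite -E mulrA mulfV// mul1r.
have D0 : D != 0.
  rewrite gt_eqF// ltr_pwDl ?sqr_ge0// exprn_gt0// (lt_le_trans _ a0)//.
move: E => [E1 E2].
set x := - (p1 / Y ^+ 2) in E1 E2; set y := - ((1 - p2 / Y ^+ 2) / Y) in E1 E2.
set x' := - (q1 / Y ^+ 2) in E1 E2; set y' := - ((1 - q2 / Y ^+ 2) / Y) in E1 E2.
have Dab : D = a ^+ 2 + b ^+ 2 by [].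
have x'E : x' = (x * a + y * b) / D.
  by apply: (canRL (mulfK D0)); rewrite E1 E2 Dab; ring.
have y'E : y' = (y * a - x * b) / D.
  by apply: (canRL (mulfK D0)); rewrite E1 E2 Dab; ring.
split.
- have -> : q1 = - Y ^+ 2 * x' by rewrite /x'; field.
  by rewrite x'E /x /y /a /b; field; rewrite D0.
- have -> : q2 = Y ^+ 2 * (1 + Y * y') by rewrite /y'; field.
  have -> : y' = (y * a - x * b) / D by [].
  apply: (mulIf D0); rewrite divfK// (_ : _ * D = Y ^+ 2 * (D + Y * (y * a - x * b))); last by field.
  by rewrite Dab /x /y /a /b; field.
Qed.

Lemma integrable_lower_powers {R : realType} (P : probability R R) (j : nat) :
  P.-integrable setT (EFin \o (fun t : R => t ^+ 4)) -> (j <= 4)%N ->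
  P.-integrable setT (EFin \o (fun t : R => t ^+ j)).
Proof.
move=> i4 j4.
have i1 : P.-integrable setT (EFin \o (fun t : R => 1 + t ^+ 4)).
  have := integrableD measurableT (finite_measure_integrable_cst P 1 measurableT) i4.
  exact: eq_integrable.
apply: (le_integrable measurableT _ _ i1).
  by apply/measurable_EFinP; exact: exprn_measurable.
move=> t _ /=; rewrite lee_fin normrX [leRHS]ger0_norm; last first.
  by rewrite addr_ge0// exprn_even_ge0.
rewrite -[t ^+ 4]ger0_norm ?exprn_even_ge0// normrX.
have [t1|t1] := leP `|t| 1.
- by rewrite (le_trans (exprn_ile1 _ _ _))// lerDl exprn_ge0.
- by rewrite (le_trans (ler_weXn2l (ltW t1) j4))// lerDr.
Qed.

Lemma boolean_power_damped_moment {R : realType} (mu nu : probability R R)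
  (n : nat) (Y : R) : (1 <= n)%N -> 0 < Y -> is_boolean_power mu n nu ->
  damped_moment mu 2 Y < Y ^+ 2 ->
  let p1 := damped_moment mu 1 Y in let p2 := damped_moment mu 2 Y in
  let D := (1 + (n%:R - 1) * (p2 / Y ^+ 2)) ^+ 2
           + ((n%:R - 1) * (p1 / Y)) ^+ 2 in
  damped_moment nu 1 Y = n%:R * p1 / D /\
  damped_moment nu 2 Y =
    n%:R * (p2 + (n%:R - 1) * (p2 ^+ 2 / Y ^+ 2 + p1 ^+ 2)) / D.
Proof.
move=> n1 Y0 nuP pY p1 p2 D.
have p20 : 0 <= p2.
  by apply: Rintegral_ge0 => t _; rewrite mulr_ge0 ?sqr_ge0// ltW// damp_gt0.
apply: boolean_power_solve => //; first by rewrite p20.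
have := nuP (Complex 0 Y) Y0.
by rewrite /Ktrans /cauchyF !cauchyG_imag.
Qed.

(** * Moments of a Boolean power, as [Y] tends to infinity *)

Section boolean_power_moments.
Variables (R : realType) (mu nu : probability R R) (n : nat).
Hypothesis n1 : (1 <= n)%N.
Hypothesis nuP : is_boolean_power mu n nu.
Hypothesis i4 : mu.-integrable setT (EFin \o (fun t : R => t ^+ 4)).
Hypothesis m1 : \int[mu]_t (t ^+ 1) = 0.
Hypothesis m2 : \int[mu]_t (t ^+ 2) = 1.

Let N : R := n%:R.
(* Starting at [Y = 2] makes [p 2 k <= 1 < Y k ^+ 2], so that [G_mu] does not vanish. *)
Let Y (k : nat) : R := k.+2%:R.
Let h (k : nat) : R := (Y k ^+ 2)^-1.
Let p j k := damped_moment mu j (Y k).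
Let q j k := damped_moment nu j (Y k).
Let D k := (1 + (N - 1) * (p 2 k * h k)) ^+ 2 + (N - 1) ^+ 2 * (h k * (p 1 k * p 1 k)).

Let Y0 k : 0 < Y k. Proof. by rewrite ltr0n. Qed.
Let Yn0 k : Y k != 0. Proof. by rewrite gt_eqF. Qed.
Let i1 : mu.-integrable setT (EFin \o (fun t : R => t ^+ 1)).
Proof. exact: integrable_lower_powers. Qed.
Let i2 : mu.-integrable setT (EFin \o (fun t : R => t ^+ 2)).
Proof. exact: integrable_lower_powers. Qed.
Let i3 : mu.-integrable setT (EFin \o (fun t : R => t ^+ 3)).
Proof. exact: integrable_lower_powers. Qed.

Let p2E k : p 2 k <= 1.
Proof.
rewrite -m2; apply: le_Rintegral => //; first exact: integrable_damped.
by move=> t _; rewrite ler_piMr ?sqr_ge0// damp_le1.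
Qed.

Let p2_lt k : p 2 k < Y k ^+ 2.
Proof. by rewrite (le_lt_trans (p2E k))// expr_gt1// ltr1n. Qed.

Let p2_ge0 k : 0 <= p 2 k.
Proof.
by apply: Rintegral_ge0 => t _; rewrite mulr_ge0 ?sqr_ge0// ltW// damp_gt0.
Qed.

(** Mean zero makes the damped mean of order [Y^-2], so that even [Y^2 * p1^2 = h * p3^2] tends to
    [0]. *)
Let p1E k : p 1 k = - (h k * p 3 k).
Proof.
have [_ +] := damped_momentSS mu 1 (Y k) (Y0 k) i1.
by rewrite m1 sub0r /p /h => ->; field.
Qed.

Let h0 : h k @[k --> \oo] --> (0 : R).
Proof. exact: cvg_shift2Vsqr. Qed.
Let cp2 : p 2 k @[k --> \oo] --> (1 : R).
Proof. by rewrite -m2; exact: cvg_damped_moment. Qed.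
Let cp1 : p 1 k @[k --> \oo] --> (0 : R).
Proof. by rewrite -m1; exact: cvg_damped_moment. Qed.

Let cD : D k @[k --> \oo] --> (1 : R).
Proof.
suff : D k @[k --> \oo] --> (1 + (N - 1) * (1 * 0)) * (1 + (N - 1) * (1 * 0))
    + (N - 1) ^+ 2 * (0 * (0 * 0)) by rewrite !(mulr0, addr0, mulr1).
apply: cvgD; last by apply: cvgMr; apply: cvgM => //; exact: cvgM.
under eq_fun do rewrite expr2.
apply: cvgM; (apply: cvgD; [exact: cvg_cst|by apply: cvgMr; exact: cvgM]).
Qed.

Let D0 k : D k != 0.
Proof.
rewrite gt_eqF// ltr_pwDl//.
  rewrite exprn_gt0// ltr_pwDl// mulr_ge0// ?subr_ge0 ?ler1n//.
  by rewrite mulr_ge0// invr_ge0 sqr_ge0.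
by rewrite mulr_ge0 ?sqr_ge0// mulr_ge0 -?expr2 ?sqr_ge0// invr_ge0 sqr_ge0.
Qed.

Let qE k : q 1 k = N * p 1 k / D k /\
  q 2 k = N * (p 2 k + (N - 1) * (p 2 k * p 2 k * h k + p 1 k * p 1 k)) / D k.
Proof.
have [e1 e2] := boolean_power_damped_moment mu nu n (Y k) n1 (Y0 k) nuP (p2_lt k).
rewrite /q e1 e2 -/(p 1 k) -/(p 2 k) -/N.
have -> : ((N - 1) * (p 1 k / Y k)) ^+ 2 = (N - 1) ^+ 2 * (h k * (p 1 k * p 1 k)).
  by rewrite /h; field.
by split.
Qed.

(** The left side is the damped fourth moment of [nu] once its second moment is known to be [N]. On
    the right the factor [Y^2] is absorbed through [Y^2 (1 - p2) = p4] and [p1E], so every term has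
    an evident limit. *)
Let q4E k : Y k ^+ 2 * (N - q 2 k) =
  (N * p 4 k + 2 * N * (N - 1) * p 2 k + N * (N - 1) ^+ 2 * (h k * (p 2 k * p 2 k))
   + N * (N - 1) ^+ 2 * (p 1 k * p 1 k)
   - N * (N - 1) * (p 2 k * p 2 k + h k * (p 3 k * p 3 k))) / D k.
Proof.
have [_ ->] := qE k.
have [_] := damped_momentSS mu 2 (Y k) (Y0 k) i2; rewrite m2 -/(p 4 k) -/(p 2 k) => ->.
apply: (mulIf (D0 k)); rewrite [RHS]divfK//.
rewrite -[Y k ^+ 2 * _ * _]mulrA mulrBl [X in _ - X]divfK//.
have hY : h k * Y k ^+ 2 = 1 by rewrite mulVf// expf_neq0.
have pp : p 1 k * p 1 k * Y k ^+ 2 = h k * (p 3 k * p 3 k).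
  by rewrite p1E /h; field.
rewrite /D -pp /h; by field; rewrite -(natrD _ 2 k) pnatr_eq0.
Qed.

(** The orders are treated as 2, 4, 1: the limit of [q 2] gives the second moment, which turns [q4E]
    into a formula for [q 4]; the fourth moment then makes [t] integrable, and the mean is
    identified by uniqueness of limits. *)
Lemma boolean_power_moments :
  [/\ nu.-integrable setT (EFin \o (fun t : R => t ^+ 4)),
    \int[nu]_t (t ^+ 1) = 0, \int[nu]_t (t ^+ 2) = N &
    \int[nu]_t (t ^+ 4) = N * \int[mu]_t (t ^+ 4) + N * (N - 1)].
Proof.
have cp3 : p 3 k @[k --> \oo] --> \int[mu]_t (t ^+ 3) by exact: cvg_damped_moment.
have cp4 : p 4 k @[k --> \oo] --> \int[mu]_t (t ^+ 4) by exact: cvg_damped_moment.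
set m3 := \int[mu]_t (t ^+ 3) in cp3; set m4 := \int[mu]_t (t ^+ 4) in cp4 *.
have [j2 n2] : nu.-integrable setT (EFin \o (fun t : R => t ^+ 2)) /\
    \int[nu]_t (t ^+ 2) = N.
  apply: integrable_of_cvg_damped_moment => //.
    by move=> k; exact: integrable_damped_le2.
  suff : q 2 k @[k --> \oo] --> N * (1 + (N - 1) * (1 * 1 * 0 + 0 * 0)) / 1.
    by rewrite !(mulr0, addr0, mulr1, divr1).
  under eq_fun do rewrite (qE _).2.
  apply: cvgM; last by apply: cvgV => //; exact: oner_neq0.
  apply: cvgMr; apply: cvgD => //; apply: cvgMr; apply: cvgD; last exact: cvgM.
  by apply: cvgM => //; exact: cvgM.
have [j4 n4] : nu.-integrable setT (EFin \o (fun t : R => t ^+ 4)) /\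
    \int[nu]_t (t ^+ 4) = N * m4 + N * (N - 1).
  apply: integrable_of_cvg_damped_moment => //.
    by move=> k; exact: (damped_momentSS nu 2 (Y k) (Y0 k) j2).1.
  (* The limit is spelled out term by term in the shape of [q4E], with [h] and [p 1] replaced by
     [0], [p 2] and [D] by [1]. *)
  have -> : N * m4 + N * (N - 1) =
      (N * m4 + 2 * N * (N - 1) * 1 + N * (N - 1) ^+ 2 * (0 * (1 * 1))
       + N * (N - 1) ^+ 2 * (0 * 0)
       - N * (N - 1) * (1 * 1 + 0 * (m3 * m3))) / 1 by field.
  set L := (X in _ --> X); suff : q 4 k @[k --> \oo] --> L by [].
  have qE4 k : q 4 k = Y k ^+ 2 * (N - q 2 k).
    by rewrite -n2; exact: (damped_momentSS nu 2 (Y k) (Y0 k) j2).2.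
  under eq_fun do rewrite qE4 q4E.
  apply: cvgM; last by apply: cvgV => //; exact: oner_neq0.
  apply: cvgB.
    apply: cvgD; last by apply: cvgMr; exact: cvgM.
    apply: cvgD; last by apply: cvgMr; apply: cvgM => //; exact: cvgM.
    by apply: cvgD; exact: cvgMr.
  apply: cvgMr; apply: cvgD; first exact: cvgM.
  by apply: cvgM => //; exact: cvgM.
split => //.
have j1 : nu.-integrable setT (EFin \o (fun t : R => t ^+ 1)).
  exact: integrable_lower_powers.
have c1 := cvg_damped_moment nu 1 j1.
apply: (cvg_unique (@Rhausdorff R) c1).
suff : q 1 k @[k --> \oo] --> N * 0 / 1 by rewrite mulr0 mul0r.
under eq_fun do rewrite (qE _).1.
apply: cvgM; last by apply: cvgV => //; exact: oner_neq0.
exact: cvgMr.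
Qed.

End boolean_power_moments.

(** * Distance to the Bernoulli law from moments up to order four *)

Lemma Rintegral_indic {R : realType} (P : probability R R) (A : set R) :
  measurable A -> \int[P]_t (\1_A t : R) = fine (P A).
Proof. by move=> mA; rewrite /Rintegral integral_indic// setIT. Qed.

Lemma bern_cdfE {R : realType} (x : R) :
  bern_cdf x = 1 / 2 * (- 1 <= x)%R%:R + 1 / 2 * (1 <= x)%R%:R.
Proof.
by rewrite /bern_cdf /bern !diracE !mem_setE !in_itv/=.
Qed.

Section levy_bound.
Variables (R : realType) (P : probability R R) (s d : R).
Hypothesis s0 : 0 < s.
Hypothesis i4 : P.-integrable setT (EFin \o (fun t : R => t ^+ 4)).
Hypothesis m1 : \int[P]_t (t ^+ 1) = 0.
Hypothesis m2 : \int[P]_t (t ^+ 2) = s ^+ 2.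
Hypothesis m4 : \int[P]_t (t ^+ 4) = s ^+ 4 * (1 + d).

(** Test polynomials whose mean is fixed by the data: after rescaling by [s], the linear term has
    mean [0] and [(x^2 - 1)^2] has mean [(1 + d) - 2 + 1 = d], while the third moment never
    enters. *)
Let quartic (a b c : R) (x : R) := a + b * x + c * (x ^+ 2 - 1) ^+ 2.

Let integral_quartic (a b c : R) :
  P.-integrable setT (EFin \o (fun t : R => quartic a b c (t / s))) /\
  \int[P]_t (quartic a b c (t / s)) = a + c * d.
Proof.
have sn0 : s != 0 by rewrite gt_eqF.
pose f j (k : R) (t : R) := k * t ^+ j.
have fi j k : (j <= 4)%N -> P.-integrable setT (EFin \o f j k).
  by move=> j4; exact: (integrableZl measurableT k (integrable_lower_powers P j i4 j4)).
have fE j k : (j <= 4)%N -> \int[P]_t (f j k t) = k * \int[P]_t (t ^+ j).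
  by move=> j4; rewrite RintegralZl//; exact: integrable_lower_powers.
have addi (g1 g2 : R -> R) : P.-integrable setT (EFin \o g1) ->
    P.-integrable setT (EFin \o g2) -> P.-integrable setT (EFin \o (g1 \+ g2)).
  move=> ig1 ig2; have := integrableD measurableT ig1 ig2; exact: eq_integrable.
pose f1 := f 0 (a + c) \+ f 1 (b / s).
pose f2 := f 2 (- (2 * c / s ^+ 2)) \+ f 4 (c / s ^+ 4).
have if1 : P.-integrable setT (EFin \o f1) by apply: addi; exact: fi.
have if2 : P.-integrable setT (EFin \o f2) by apply: addi; exact: fi.
have qE : (fun t => quartic a b c (t / s)) = f1 \+ f2.
  by apply/funext => t; rewrite /quartic /f1 /f2 /f/=; field.
rewrite qE; split; first exact: addi.
rewrite RintegralD// !RintegralD ?fi//.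
rewrite !fE// m1 m2 m4.
have -> : \int[P]_t (t ^+ 0) = 1.
  under eq_Rintegral do rewrite expr0.
  by rewrite Rintegral_cst// mul1r; have -> : fine (P setT) = 1 by rewrite probability_setT.
by field.
Qed.

(** Chebyshev's method: a pointwise comparison of an indicator with a quartic is integrated. All
    mass estimates below come from this bound or its reverse [mass_ge]. *)
Let mass_le (A : set R) (a b c : R) : measurable A ->
  (forall x, \1_A x <= quartic a b c (x / s)) -> fine (P A) <= a + c * d.
Proof.
move=> mA le1; have [iq <-] := integral_quartic a b c.
rewrite -Rintegral_indic//; apply: le_Rintegral => //.
exact: integrable_indic.
Qed.

Let mass_ge (A : set R) (a b c : R) : measurable A ->
  (forall x, quartic a b c (x / s) <= \1_A x) -> a + c * d <= fine (P A).
Proof.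
move=> mA le1; have [iq <-] := integral_quartic a b c.
rewrite -Rintegral_indic//; apply: le_Rintegral => //.
exact: integrable_indic.
Qed.

(** [d] is the mean of the square [(x^2 - 1)^2]; the empty set in [mass_le] extracts this. *)
Lemma fourth_moment_excess_ge0 : 0 <= d.
Proof.
have := @mass_le set0 0 0 1 measurable0.
rewrite !add0r mul1r measure0; apply => x.
by rewrite indic0 /quartic mul0r !add0r mul1r sqr_ge0.
Qed.

Let F x := fine (P `]-oo, x * s]%classic).

Let F_ge0 x : 0 <= F x. Proof. by rewrite fine_ge0. Qed.
Let F_le1 x : F x <= 1.
Proof. by rewrite -lee_fin fineK ?fin_num_measure// probability_le1. Qed.

Let tail_compl x : fine (P `]x * s, +oo[%classic) = 1 - F x.
Proof.
by rewrite /F -setCitvl probability_setC// fineB// fin_num_measure.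
Qed.

Let in_left x t : (t \in `]-oo, x * s]) = (t / s <= x).
Proof. by rewrite in_itv/= ler_pdivrMr. Qed.
Let in_right x t : (t \in `]x * s, +oo[) = (x < t / s).
Proof. by rewrite in_itv/= andbT ltr_pdivlMr. Qed.

Variable e : R.
(** The constant [42] lies just below [(7/2)^3 = 42.875]. The estimates below call for
    [d / (4 e^2) <= e] and [e^2 / 16 + d / e^2 <= e]. *)
Hypotheses (e0 : 0 < e) (e1 : e < 1) (de : 42 * d <= e ^+ 3).

Let sq_le (w : R) : 2 * e <= w -> 4 * e ^+ 2 <= w ^+ 2.
Proof.
move=> ew; have : 0 <= (w - 2 * e) * (w + 2 * e).
  by rewrite mulr_ge0//; move: e0; lra.
lra.
Qed.

(** Beyond [-1 - e] one has [y^2 - 1 >= 2 e], so Chebyshev's inequality bounds the mass by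
    [d / (4 e^2)]. The right tail is symmetric. *)
Lemma left_tail : F (- 1 - e) <= e.
Proof.
have : F (- 1 - e) <= 0 + (4 * e ^+ 2)^-1 * d.
  apply: (@mass_le _ 0 0) => // x.
  rewrite indicE mem_setE in_left /quartic mul0r !add0r.
  set y := x / s; have [ye|ye] := leP y (- 1 - e); last first.
    by rewrite mulr_ge0 ?sqr_ge0// invr_ge0 mulr_ge0 ?sqr_ge0.
  rewrite mulrC ler_pdivlMr ?mulr_gt0 ?exprn_gt0// mul1r.
  have ey : 2 * e <= y ^+ 2 - 1 by nra.
  exact: sq_le.
move=> /le_trans; apply; rewrite add0r mulrC ler_pdivrMr ?mulr_gt0 ?exprn_gt0//.
have := fourth_moment_excess_ge0; move: de; rewrite !exprS expr0; lra.
Qed.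

Lemma right_tail : 1 - F (1 + e) <= e.
Proof.
have : fine (P `](1 + e) * s, +oo[%classic) <= 0 + (4 * e ^+ 2)^-1 * d.
  apply: (@mass_le _ 0 0) => // x.
  rewrite indicE mem_setE in_right /quartic mul0r !add0r.
  set y := x / s; have [ye|ye] := ltP (1 + e) y; last first.
    by rewrite mulr_ge0 ?sqr_ge0// invr_ge0 mulr_ge0 ?sqr_ge0.
  rewrite mulrC ler_pdivlMr ?mulr_gt0 ?exprn_gt0// mul1r.
  have ey : 2 * e <= y ^+ 2 - 1 by nra.
  exact: sq_le.
rewrite tail_compl.
move=> /le_trans; apply; rewrite add0r mulrC ler_pdivrMr ?mulr_gt0 ?exprn_gt0//.
have := fourth_moment_excess_ge0; move: de; rewrite !exprS expr0; lra.
Qed.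

(* The left-hand side has mean close to [1/2], since [y] will have mean zero
   and [(y^2 - 1)^2] a small one; the constant [e^2/16] is the AM-GM loss in
   [w/2 - w^2/e^2 <= e^2/16]. *)
Lemma bump_le (y : R) :
  (1 + y) / 2 - e ^+ 2 / 16 - (y ^+ 2 - 1) ^+ 2 / e ^+ 2
    <= (1 - e < y)%R%:R.
Proof.
have e20 : 0 < e ^+ 2 by rewrite exprn_gt0.
have amgm w : 0 <= w -> w / 2 - e ^+ 2 / 16 <= w ^+ 2 / e ^+ 2.
  move=> w0; rewrite ler_pdivlMr//; have := sqr_ge0 (w - e ^+ 2 / 4); nra.
have sq : (y ^+ 2 - 1) ^+ 2 = (1 + y) ^+ 2 * (1 - y) ^+ 2 by ring.
have c0 : 0 <= (y ^+ 2 - 1) ^+ 2 / e ^+ 2 by rewrite divr_ge0 ?sqr_ge0.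
have [ye|ye] := ltP (1 - e) y.
  have [y1|y1] := leP y 1; first by rewrite /=; lra.
  (* Past [1] the overshoot [(y - 1) / 2] is absorbed by the quartic penalty, because
     [(1 + y)^2 >= 1]. *)
  have := amgm (y - 1); rewrite subr_ge0 (ltW y1) => /(_ isT).
  have : (y - 1) ^+ 2 / e ^+ 2 <= (y ^+ 2 - 1) ^+ 2 / e ^+ 2.
    by rewrite ler_pM2r ?invr_gt0// sq; have := sqr_ge0 (y - 1); nra.
  by rewrite /=; lra.
rewrite /=.
have [y1|y1] := leP (1 + y) 0; first by nra.
(* For [-1 < y <= 0], [(1 - y)^2 >= 1] and AM-GM applies to [w = 1 + y]. For [0 < y <= 1 - e],
   [(1 - y)^2 >= e^2] cancels the denominator and [(1 + y)^2] dominates [(1 + y) / 2]. *)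
have [y0|y0] := leP y 0.
  have := amgm (1 + y) (ltW y1).
  have : (1 + y) ^+ 2 / e ^+ 2 <= (y ^+ 2 - 1) ^+ 2 / e ^+ 2.
    by rewrite ler_pM2r ?invr_gt0// sq; have := sqr_ge0 (1 + y); nra.
  lra.
have : (1 + y) / 2 <= (y ^+ 2 - 1) ^+ 2 / e ^+ 2.
  rewrite ler_pdivlMr// sq.
  have h1 : e ^+ 2 <= (1 - y) ^+ 2.
    have : 0 <= (1 - y - e) * (1 - y + e) by rewrite mulr_ge0//; move: e0; lra.
    lra.
  have h2 : (1 + y) / 2 <= (1 + y) ^+ 2.
    have : 0 <= (1 + y) * (1 / 2 + y) by rewrite mulr_ge0//; lra.
    lra.
  by rewrite ler_pM// ltW// divr_gt0.
lra.
Qed.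

Let bump_mass : 1 / 2 - e <= 1 / 2 - e ^+ 2 / 16 + (- (e ^+ 2)^-1) * d.
Proof.
have : (e ^+ 2)^-1 * d <= e / 42.
  by rewrite mulrC ler_pdivrMr ?exprn_gt0//; move: de; rewrite !exprS expr0; lra.
have : 0 <= e * (1 - e) by rewrite mulr_ge0// ?subr_ge0 ltW.
by move: e0; lra.
Qed.

(** Integrating [bump_le] puts mass at least [1/2 - e] to the right of [1 - e]: the linear term
    vanishes by mean zero. Reflecting [y] to [-y] gives [left_mass]. *)
Lemma right_mass : F (1 - e) <= 1 / 2 + e.
Proof.
suff : 1 / 2 - e <= 1 - F (1 - e) by lra.
rewrite -tail_compl; apply: (le_trans bump_mass).
apply: (@mass_ge _ _ (1 / 2)) => // x.
rewrite indicE mem_setE in_right.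
by apply: le_trans (bump_le _); rewrite /quartic; lra.
Qed.

Lemma left_mass : 1 / 2 - e <= F (- 1 + e).
Proof.
apply: (le_trans bump_mass).
apply: (@mass_ge _ _ (- (1 / 2))) => // x.
rewrite indicE mem_setE in_left.
apply: (@le_trans _ _ (1 - e < - (x / s))%R%:R); last first.
  have [h|h] := ltP (1 - e) (- (x / s)); last by rewrite ler0n.
  by have -> : x / s <= - 1 + e by lra.
by apply: le_trans (bump_le _); rewrite sqrrN /quartic; lra.
Qed.

Let F_mono x y : x <= y -> F x <= F y.
Proof.
move=> xy; apply: fine_le; rewrite ?fin_num_measure//.
apply: le_measure; rewrite ?inE//.
by apply: subset_itvl; rewrite bnd_simp ler_pM2r.
Qed.

(** [bern_cdf] is constant on each of the three ranges cut out by [-1] and [1]; there monotonicity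
    of [F] reduces the claim to the four estimates at [-1 - e], [-1 + e], [1 - e] and [1 + e]. *)
Lemma bern_cdf_close (x : R) :
  F (x - e) - e <= bern_cdf x /\ bern_cdf x <= F (x + e) + e.
Proof.
rewrite bern_cdfE.
have [x1|x1] := leP 1 x.
  have -> : - 1 <= x by lra.
  have : F (1 + e) <= F (x + e) by apply: F_mono; lra.
  by have := right_tail; have := F_le1 (x - e); move: e0; rewrite /=; lra.
have [x2|x2] := leP (- 1) x.
  have : F (x - e) <= F (1 - e) by apply: F_mono; lra.
  have : F (- 1 + e) <= F (x + e) by apply: F_mono; lra.
  by have := right_mass; have := left_mass; rewrite /=; lra.
have : F (x - e) <= F (- 1 - e) by apply: F_mono; lra.
by have := left_tail; have := F_ge0 (x + e); move: e0; rewrite /=; lra.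
Qed.

End levy_bound.

(** * Combining the moment identities with the distance bound *)

Theorem theorem1 (R : realType) (mu : probability R R)
  (hm1 : moment mu 1 = 0%E) (hm2 : moment mu 2 = 1%E)
  (hm4 : (moment mu 4 < +oo)%E) :
  forall (n : nat), (1 <= n)%N ->
  forall nu : probability R R, is_boolean_power mu n nu ->
    levy (dilation_cdf (1 / Num.sqrt (n%:R)) nu) (@bern_cdf R)
      <= 7 / 2 * ((fine (moment mu 4) - 1) / n%:R) `^ (1 / 3).
Proof.
move=> n n1 nu nuP.
have N0 : 0 < n%:R :> R by rewrite ltr0n.
set s := Num.sqrt n%:R; have s0 : 0 < s by rewrite sqrtr_gt0.
have sN : s ^+ 2 = n%:R by rewrite sqr_sqrtr// ltW.
have i4 : mu.-integrable setT (EFin \o (fun t : R => t ^+ 4)).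
  apply/integrableP; split; first by apply/measurable_EFinP; exact: exprn_measurable.
  under eq_integral do rewrite /= ger0_norm ?exprn_even_ge0//.
  exact: hm4.
have m1 : \int[mu]_t (t ^+ 1) = 0 by rewrite /Rintegral -/(moment mu 1) hm1.
have m2 : \int[mu]_t (t ^+ 2) = 1 by rewrite /Rintegral -/(moment mu 2) hm2.
rewrite (_ : fine (moment mu 4) = \int[mu]_t (t ^+ 4))//.
set m4 := \int[mu]_t (t ^+ 4); set d := (m4 - 1) / n%:R.
have [j4 k1 k2 k4] := boolean_power_moments R mu nu n n1 nuP i4 m1 m2.
have {}k2 : \int[nu]_t (t ^+ 2) = s ^+ 2 by rewrite k2 sN.
(* With [N = s^2], [N m4 + N (N - 1) = N^2 (1 + (m4 - 1) / N)], which is where [d] comes from. *)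
have {}k4 : \int[nu]_t (t ^+ 4) = s ^+ 4 * (1 + d).
  have -> : s ^+ 4 = n%:R * n%:R by rewrite -sN; ring.
  rewrite k4 -/m4 /d; move: (n%:R : R) N0 => N N0; field.
  by rewrite gt_eqF.
have d0 : 0 <= d by exact: (fourth_moment_excess_ge0 R nu s d s0 j4 k1 k2 k4).
set r := d `^ (1 / 3).
have r0 : 0 <= r by exact: powR_ge0.
have r3 : r ^+ 3 = d.
  by rewrite -powR_mulrn// -powRrM (_ : 1 / 3 * 3%:R = 1) ?powRr1//; field.
have FE x : dilation_cdf (1 / s) nu x = fine (nu `]-oo, x * s]%classic).
  by rewrite /dilation_cdf div1r invrK.
(* The infimum runs over strictly positive [e], while the bound itself is [0] when [d = 0]; hence
   the slack [eps]. *)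
apply/ler_addgt0Pr => eps eps0; apply: ge_inf.
  by exists 0 => x [/ltW].
set e := 7 / 2 * r + eps.
have e0 : 0 < e by rewrite ltr_wpDl// mulr_ge0.
split=> // x; rewrite !FE.
(* For [e >= 1] the inequalities hold for any two functions with values in [[0, 1]]. *)
have [e1|e1] := ltP e 1; last first.
  have F01 y : 0 <= fine (nu `]-oo, y]%classic) <= 1.
    rewrite fine_ge0//= -lee_fin fineK ?fin_num_measure// probability_le1//.
  have /andP[_ u1] := F01 ((x - e) * s); have /andP[u2 _] := F01 ((x + e) * s).
  rewrite bern_cdfE.
  have b01 (b : bool) : 0 <= (b%:R : R) <= 1 by rewrite ler0n lern1 leq_b1.
  have /andP[v1 v2] := b01 (- 1 <= x)%R; have /andP[w1 w2] := b01 (1 <= x)%R.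
  lra.
apply: (bern_cdf_close R nu s d s0 j4 k1 k2 k4 e e0 e1).
have : (7 / 2 * r) ^+ 3 <= e ^+ 3.
  by rewrite lerXn2r ?nnegrE ?(ltW e0) ?mulr_ge0// lerDl ltW.
apply: le_trans; rewrite exprMn r3.
have -> : 42 * d = d * 42 by ring.
have -> : (7 / 2) ^+ 3 * d = d * ((7 / 2) ^+ 3) by ring.
by rewrite ler_wpM2l//; lra.
Qed.
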